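(* Let $d>1$, $n\ge1$. Let $\boldsymbol{\theta}\sim\mathcal{N}(\boldsymbol{\mu}^{\pi},\Sigma^{\pi})$ on $\mathbb{R}^d$ and, given $\boldsymbol{\theta}$, let ${\bf y}_1,\dots,{\bf y}_n$ be i.i.d. $\mathcal{N}(\boldsymbol{\theta},\Lambda)$, where $\Sigma^{\pi}$ and $\Lambda$ are known positive definite $d\times d$ covariance matrices. Unless there is a non-zero constant $c$ such that $c\Lambda=\Sigma^{\pi}$, the following holds with probability one, with respect to the joint distribution of $(\boldsymbol{\theta},{\bf y})$: there exists a nontrivial (i.e. non-degenerate, of positive volume) set of $\boldsymbol{\lambda}\in\mathbb{R}^d$ such that the discrepant posterior phenomenon (DPP) occurs for $\eta=\boldsymbol{\lambda}^{\top}\boldsymbol{\theta}$.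
   Context: The likelihood is $L(\boldsymbol{\theta}\mid{\bf y})\propto\phi(\boldsymbol{\theta};\boldsymbol{\mu}^{L},\Sigma^{L})$ with $\boldsymbol{\mu}^{L}=\overline{\bf y}_n=\frac1n\sum_{i=1}^n{\bf y}_i$ and $\Sigma^{L}=\Lambda/n$, where $\phi(\cdot;\boldsymbol{\mu},\Sigma)$ is the Gaussian density with mean $\boldsymbol{\mu}$ and covariance $\Sigma$. $\boldsymbol{\mu}^{p}$ denotes the posterior mean of $\boldsymbol{\theta}$ given ${\bf y}=({\bf y}_1,\dots,{\bf y}_n)$. For $\boldsymbol{\lambda}\in\mathbb{R}^d$ write $\eta^{p}=\boldsymbol{\lambda}^{\top}\boldsymbol{\mu}^{p}$, $\eta^{\pi}=\boldsymbol{\lambda}^{\top}\boldsymbol{\mu}^{\pi}$, $\eta^{L}=\boldsymbol{\lambda}^{\top}\boldsymbol{\mu}^{L}$. Definition: the discrepant posterior phenomenon (DPP) occurs for $\eta=\boldsymbol{\lambda}^{\top}\boldsymbol{\theta}$ if $(\eta^{p}-\eta^{\pi})(\eta^{p}-\eta^{L})>0$. The set of such $\boldsymbol{\lambda}$ may depend on the data ${\bf y}$. *)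

(* Defs.v *)
From HB Require Import structures.
From mathcomp Require Import all_boot all_order all_algebra.
From mathcomp Require Import all_classical all_reals all_analysis.

Set Implicit Arguments.
Unset Strict Implicit.
Unset Printing Implicit Defensive.

Import Order.TTheory GRing.Theory Num.Theory.
Import numFieldNormedType.Exports.

Local Open Scope classical_set_scope.
Local Open Scope ring_scope.

(* R^d is 'cV[R]_d with the sigma-algebra generated by the coordinates; this
   is the construction the library uses for n.-tuple T. *)
Section measurable_cV.
Context {d} {T : sigmaRingType d}.
Variable n : nat.

Definition cv_coord (i : 'I_n) (x : 'cV[T]_n) : T := x i ord0.

Let cv_set0 : g_sigma_preimage cv_coord set0.
Proof. exact: sigma_algebra0. Qed.

Let cv_setC A : g_sigma_preimage cv_coord A -> g_sigma_preimage cv_coord (~` A).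
Proof. exact: sigma_algebraC. Qed.

Let cv_bigcup (F : _^nat) : (forall i, g_sigma_preimage cv_coord (F i)) ->
  g_sigma_preimage cv_coord (\bigcup_i (F i)).
Proof. exact: sigma_algebra_bigcup. Qed.

HB.instance Definition _ := @isMeasurable.Build (measure_tuple_display d)
  'cV[T]_n (g_sigma_preimage cv_coord) cv_set0 cv_setC cv_bigcup.

End measurable_cV.

Lemma measurable_cv_coord d (T : sigmaRingType d) n (i : 'I_n) :
  measurable_fun [set: 'cV[T]_n] (cv_coord i).
Proof.
move=> _ Y mY; rewrite setTI; apply: sub_sigma_algebra => /=.
rewrite -bigcup_seq/=; exists i => /=; first by rewrite mem_index_enum.
by exists Y => //; rewrite setTI.
Qed.

Lemma measurable_fun_cvP d1 d2 (T1 : measurableType d1) (T2 : measurableType d2)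
    n (f : T1 -> 'cV[T2]_n) :
  measurable_fun [set: T1] f <->
  forall i, measurable_fun [set: T1] (cv_coord i \o f).
Proof.
split=> [mf i|mf].
  by apply: (@measurableT_comp _ _ _ _ _ _ (cv_coord i)) => //;
    exact: measurable_cv_coord.
move=> _ A mA; rewrite setTI.
suff : g_sigma_preimage (@cv_coord d2 T2 n) `<=` [set B | measurable (f @^-1` B)].
  exact.
apply: smallest_sub.
  split => /=.
  - by rewrite preimage_set0.
  - by move=> B mB; rewrite setTD preimage_setC; exact: measurableC.
  - by move=> F mF; rewrite preimage_bigcup; exact: bigcup_measurable.
case: n => [|n] in f mf A mA *; first by rewrite big_ord0.
rewrite -bigcup_mkord_ord; apply: bigcup_sub => i Ii.
move=> _ [B mB <-] /=; rewrite setTI.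
by rewrite -[X in measurable X]setTI; exact: mf.
Qed.

Section lebesgue_cV.
Context {R : realType}.

Definition cv_cons d (p : R * 'cV[R]_d) : 'cV[R]_d.+1 :=
  col_mx (const_mx p.1 : 'cV[R]_1) p.2.

Definition cv_uncons d (x : 'cV[R]_d.+1) : R * 'cV[R]_d :=
  (x ord0 ord0, @dsubmx R 1 d 1 x).

Lemma cv_cons0 d (p : R * 'cV[R]_d) : cv_cons p ord0 ord0 = p.1.
Proof. by rewrite /cv_cons mxE; case: splitP => // j _; rewrite mxE. Qed.

Lemma cv_consS d (p : R * 'cV[R]_d) (i : 'I_d) :
  cv_cons p (lift ord0 i) ord0 = p.2 i ord0.
Proof.
rewrite /cv_cons mxE; case: splitP => j /=; rewrite /bump/= add1n; last first.
  by move=> [ij]; congr (p.2 _ _); exact/val_inj.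
by case: j => -[].
Qed.

Lemma cv_consK d : cancel (@cv_cons d) (@cv_uncons d).
Proof. by move=> [x v]; rewrite /cv_uncons cv_cons0 /cv_cons col_mxKd. Qed.

Lemma measurable_cv_cons d : measurable_fun [set: R * 'cV[R]_d] (@cv_cons d).
Proof.
apply/measurable_fun_cvP => i; case: (unliftP ord0 i) => [j ->|->].
  rewrite (_ : _ \o _ = cv_coord j \o snd); last first.
    by apply/funext => p; exact: cv_consS.
  apply: (@measurableT_comp _ _ _ _ _ _ (cv_coord j)) => //.
  exact: measurable_cv_coord.
rewrite (_ : _ \o _ = fst) //; apply/funext => p; exact: cv_cons0.
Qed.

Lemma measurable_cv_uncons d : measurable_fun [set: 'cV[R]_d.+1] (@cv_uncons d).
Proof.
apply: measurable_fun_pair; first exact: (measurable_cv_coord ord0).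
apply/measurable_fun_cvP => i.
rewrite (_ : _ \o _ = cv_coord (lift ord0 i)); first exact: measurable_cv_coord.
apply/funext => x /=; rewrite /cv_coord /= mxE; congr (x _ _); exact/val_inj.
Qed.

Section step.
(* The library's sigma-finite instance for m1 \x m2 is shadowed by the one for
   subprobabilities, hence the direct proof below. *)
Variables (d : nat) (m : {sigma_finite_measure set 'cV[R]_d -> \bar R}).

Let prod_m : {measure set (measurableTypeR R * 'cV[R]_d)%type -> \bar R} :=
  (@lebesgue_measure R \x m)%E.

Let prod_m_sigma_finite : sigma_finite setT prod_m.
Proof.
have /sigma_finiteP[F [TF ndF Foo]] := sigma_finiteT (@lebesgue_measure R).
have /sigma_finiteP[G [TG ndG Goo]] := sigma_finiteT m.
exists (fun k => F k `*` G k).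
  rewrite -setXTT TF TG predeqE => -[x y]; split.
    move=> [/= [k _ Fkx] [l _ Gly]]; exists (maxn k l) => //; split.
    - by move: x Fkx; exact/subsetPset/ndF/leq_maxl.
    - by move: y Gly; exact/subsetPset/ndG/leq_maxr.
  by move=> [k _ []/= ? ?]; split; exists k.
move=> k; have [? ?] := Foo k; have [? ?] := Goo k.
split; first exact: measurableX.
by rewrite /prod_m /= product_measure1E// lte_mul_pinfty// ge0_fin_numE.
Qed.

Definition lebesgue_cV_step : set 'cV[R]_d.+1 -> \bar R :=
  pushforward (@lebesgue_measure R \x m)%E (@cv_cons d).

Let step0 : lebesgue_cV_step set0 = 0%E.
Proof. by rewrite /lebesgue_cV_step /pushforward preimage_set0 measure0. Qed.

Let step_ge0 A : (0 <= lebesgue_cV_step A)%E.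
Proof. exact: (measure_ge0 prod_m). Qed.

Let step_preimage A : measurable A -> measurable (@cv_cons d @^-1` A : set (measurableTypeR R * 'cV[R]_d)).
Proof.
by move=> mA; rewrite -[_ @^-1` _]setTI; exact: measurable_cv_cons.
Qed.

Let step_sigma_additive : semi_sigma_additive lebesgue_cV_step.
Proof.
move=> F mF tF mUF; rewrite /lebesgue_cV_step /pushforward preimage_bigcup.
apply: (@measure_semi_sigma_additive _ _ _ prod_m).
- by move=> k; exact: step_preimage.
- apply/trivIsetP => /= i j _ _ ij; rewrite -preimage_setI.
  by move/trivIsetP : tF => /(_ _ _ _ _ ij) ->//; rewrite preimage_set0.
- by rewrite -preimage_bigcup; exact: step_preimage.
Qed.

HB.instance Definition _ := isMeasure.Build _ _ _ lebesgue_cV_step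
  step0 step_ge0 step_sigma_additive.

Let step_sigma_finite : sigma_finite [set: 'cV[R]_d.+1] lebesgue_cV_step.
Proof.
have [F TF Foo] := prod_m_sigma_finite.
exists (fun k => @cv_uncons d @^-1` F k).
  by rewrite -preimage_bigcup -TF preimage_setT.
move=> k; have [mF Fk] := Foo k; split.
  by rewrite -[X in measurable X]setTI; exact: measurable_cv_uncons.
rewrite /lebesgue_cV_step /pushforward -comp_preimage.
by rewrite (_ : _ \o _ = id)//; apply/funext => p /=; rewrite cv_consK.
Qed.

HB.instance Definition _ := Measure_isSigmaFinite.Build _ _ _ lebesgue_cV_step
  step_sigma_finite.

End step.

(* d-dimensional Lebesgue measure: the d-fold product of lebesgue_measure,
   transported along R * R^d ~ R^d.+1. *)
Fixpoint lebesgue_cV (d : nat) : {sigma_finite_measure set 'cV[R]_d -> \bar R} :=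
  match d with
  | 0%N => @dirac _ 'cV[R]_0 0 R
  | d'.+1 => lebesgue_cV_step (lebesgue_cV d')
  end.

End lebesgue_cV.

Section gaussian.
Context {R : realType} {d : nat}.
Implicit Types (mu x t : 'cV[R]_d) (Sigma : 'M[R]_d).

Definition posdefmx Sigma :=
  Sigma^T = Sigma /\ forall x, x != 0 -> 0 < (x^T *m Sigma *m x) 0 0.

Definition gauss_pdf mu Sigma x : R :=
  (Num.sqrt ((2 * pi) ^+ d * \det Sigma))^-1 *
  expR (- (((x - mu)^T *m invmx Sigma *m (x - mu)) 0 0) / 2).

Definition gauss mu Sigma (A : set 'cV[R]_d) : \bar R :=
  (\int[lebesgue_cV d]_(x in A) (gauss_pdf mu Sigma x)%:E)%E.

End gaussian.

Section model.
Context {R : realType} {d n : nat}.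
Implicit Types (mupi t lam : 'cV[R]_d) (Sigmapi Lambda : 'M[R]_d).
Implicit Types (y : 'I_n -> 'cV[R]_d).

(* theta ~ N(mupi, Sigmapi) and, given theta, the Y i are iid N(theta, Lambda):
   integrating N(t, Lambda)(B 0) * ... * N(t, Lambda)(B n.-1) over t in A
   against the law of theta gives the probability of the rectangle. *)
Definition normal_normal_model (disp : measure_display)
    (Omega : measurableType disp) (P : probability Omega R)
    mupi Sigmapi Lambda
    (theta : {RV P >-> 'cV[R]_d}) (Y : 'I_n -> {RV P >-> 'cV[R]_d}) : Prop :=
  (forall A : set 'cV[R]_d, measurable A ->
     distribution P theta A = gauss mupi Sigmapi A) /\
  (forall (A : set 'cV[R]_d) (B : 'I_n -> set 'cV[R]_d),
     measurable A -> (forall i, measurable (B i)) ->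
     P [set w | A (theta w) /\ forall i, B i (Y i w)] =
     (\int[distribution P theta]_(t in A)
        \prod_(i < n) gauss t Lambda (B i))%E).

Definition likelihood Lambda y t : R := \prod_(i < n) gauss_pdf t Lambda (y i).

Definition posterior_pdf mupi Sigmapi Lambda y t : R :=
  gauss_pdf mupi Sigmapi t * likelihood Lambda y t /
  (\int[lebesgue_cV d]_s (gauss_pdf mupi Sigmapi s * likelihood Lambda y s)).

Definition posterior_mean mupi Sigmapi Lambda y : 'cV[R]_d :=
  \col_k \int[lebesgue_cV d]_t
    (t k ord0 * posterior_pdf mupi Sigmapi Lambda y t).

(* As a function of t, likelihood Lambda y t is proportional to
   gauss_pdf (likelihood_mean y) (n%:R^-1 *: Lambda) t. *)
Definition likelihood_mean y : 'cV[R]_d := n%:R^-1 *: \sum_(i < n) y i.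

Definition lin lam (mu : 'cV[R]_d) : R := (lam^T *m mu) 0 0.

Definition dpp mupi Sigmapi Lambda y lam : Prop :=
  let eta_p := lin lam (posterior_mean mupi Sigmapi Lambda y) in
  let eta_pi := lin lam mupi in
  let eta_L := lin lam (likelihood_mean y) in
  0 < (eta_p - eta_pi) * (eta_p - eta_L).

End model.

(* Main.v *)
Require Import Defs.
From HB Require Import structures.
From mathcomp Require Import all_boot all_order all_algebra.
From mathcomp Require Import all_classical all_reals all_analysis.
From mathcomp Require Import measurable_realfun ring lra.

(** Write v = sum_i (y_i - mupi), S for Sigmapi and L for Lambda. Completing the
    square, the posterior is a Gaussian kernel with precision matrix
    Q = S^-1 + n L^-1 centred at the solution mu_p of
    Q mu_p = S^-1 mupi + L^-1 sum_i y_i, and the reflection of R^d about mu_p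
    identifies mu_p as its mean. Hence Q (mu_p - mupi) = L^-1 v and
    Q (mu_p - mean y) = - n^-1 S^-1 v, and these two vectors are linearly
    independent unless v = 0 or S^-1 v = c L^-1 v for some c. Independent
    vectors have a direction on which both are positive, and the discrepancy
    persists on a neighbourhood of that direction. As S is not proportional to
    L, the exceptional v lie in finitely many hyperplanes, one for each
    eigenvalue of L S^-1, and each of them has probability zero. *)

Set Implicit Arguments.
Unset Strict Implicit.
Unset Printing Implicit Defensive.

Import Order.TTheory GRing.Theory Num.Theory.
Import numFieldNormedType.Exports.

Local Open Scope classical_set_scope.
Local Open Scope ring_scope.

(** * Lebesgue measure on column vectors *)

Section lebesgue_cV_integral.
Context {R : realType}.
Local Notation leb := (@lebesgue_measure R).

Let mcons d : @measurable_fun _ _ (measurableTypeR R * 'cV[R]_d)%type _ setT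
  (@cv_cons R d).
Proof. exact: measurable_cv_cons. Qed.

(** By construction the measure on R^(d+1) is the image of a product measure under [cv_cons]: change
    variables, then apply Tonelli. *)
Lemma ge0_integral_cVS d (f : 'cV[R]_d.+1 -> \bar R) :
  measurable_fun [set: 'cV[R]_d.+1] f -> (forall y, 0 <= f y)%E ->
  (\int[lebesgue_cV d.+1]_y f y =
   \int[leb]_x \int[lebesgue_cV d]_z f (cv_cons (x, z)))%E.
Proof.
move=> mf f0.
pose mu : {measure set (measurableTypeR R * 'cV[R]_d)%type -> \bar R} :=
  (leb \x lebesgue_cV d)%E.
have := @ge0_integral_pushforward _ _ (measurableTypeR R * 'cV[R]_d)%type _ R
  (@cv_cons R d) (@mcons d) mu setT f measurableT mf (fun y _ => f0 y).
rewrite preimage_setT => e; apply: (etrans e).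
exact: (@fubini_tonelli1 _ _ (measurableTypeR R) 'cV[R]_d R leb (lebesgue_cV d)
  (f \o @cv_cons R d) (measurableT_comp mf (@mcons d)) (fun p => f0 _)).
Qed.

Lemma ge0_integral_cVS_swap d (f : 'cV[R]_d.+1 -> \bar R) :
  measurable_fun [set: 'cV[R]_d.+1] f -> (forall y, 0 <= f y)%E ->
  (\int[lebesgue_cV d.+1]_y f y =
   \int[lebesgue_cV d]_z \int[leb]_x f (cv_cons (x, z)))%E.
Proof.
move=> mf f0; rewrite ge0_integral_cVS//.
exact: (@fubini_tonelli _ _ (measurableTypeR R) 'cV[R]_d R leb (lebesgue_cV d)
  (f \o @cv_cons R d) (measurableT_comp mf (@mcons d)) (fun p => f0 _)).
Qed.

Lemma measurable_integral_consl d (f : 'cV[R]_d.+1 -> \bar R) :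
  measurable_fun [set: 'cV[R]_d.+1] f -> (forall y, 0 <= f y)%E ->
  measurable_fun [set: R] (fun x => \int[lebesgue_cV d]_z f (cv_cons (x, z)))%E.
Proof.
move=> mf f0.
exact: (@measurable_fun_fubini_tonelli_F _ _ (measurableTypeR R) 'cV[R]_d R
  (lebesgue_cV d) (f \o @cv_cons R d) (measurableT_comp mf (@mcons d))
  (fun p => f0 _)).
Qed.

Lemma measurable_integral_consr d (f : 'cV[R]_d.+1 -> \bar R) :
  measurable_fun [set: 'cV[R]_d.+1] f -> (forall y, 0 <= f y)%E ->
  measurable_fun [set: 'cV[R]_d] (fun z => \int[leb]_x f (cv_cons (x, z)))%E.
Proof.
move=> mf f0.
exact: (@measurable_fun_fubini_tonelli_G _ _ (measurableTypeR R) 'cV[R]_d R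
  leb (f \o @cv_cons R d) (measurableT_comp mf (@mcons d)) (fun p => f0 _)).
Qed.

Lemma measurable_cv_consl d x :
  measurable_fun [set: 'cV[R]_d] (fun z => cv_cons (x, z)).
Proof.
exact: (measurableT_comp (@mcons d) (@pair1_measurable _ _ (measurableTypeR R) _ _)).
Qed.

Lemma integral_cV0 (f : 'cV[R]_0 -> \bar R) :
  measurable_fun [set: 'cV[R]_0] f -> (\int[lebesgue_cV 0]_y f y = f 0%R)%E.
Proof. by move=> mf; rewrite integral_dirac// diracT mul1e. Qed.

(** The image of Lebesgue measure under the reflection gives each half-open interval its length, so
    it is Lebesgue measure by uniqueness. *)
Lemma ge0_integral_reflect (a : R) (f : R -> \bar R) :
  measurable_fun [set: R] f -> (forall x, 0 <= f x)%E ->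
  (\int[leb]_x f (a - x)%R = \int[leb]_x f x)%E.
Proof.
move=> mf f0; pose phi (x : measurableTypeR R) : measurableTypeR R := a - x.
have mphi : @measurable_fun _ _ (measurableTypeR R) (measurableTypeR R) setT phi.
  exact: measurable_funB.
have e := @ge0_integral_pushforward _ _ (measurableTypeR R) (measurableTypeR R) R
  phi mphi leb setT f measurableT mf (fun y _ => f0 y).
rewrite preimage_setT in e; rewrite -[LHS]e.
pose nu : {measure set (measurableTypeR R) -> \bar R} :=
  measure_function_pushforward__canonical__measure_function_Measure leb mphi.
apply: eq_measure_integral => A mA _; apply/esym.
apply: (@lebesgue_measure_unique _ nu) => // _ [[b c]] _ <-.
rewrite /nu /= /pushforward.
(* The reflection exchanges which end of the interval is closed, but keeps the length. *)
rewrite (_ : phi @^-1` _ = `[a - c, a - b[%classic); last first.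
  apply/seteqP; split => x /=; rewrite !in_itv/= /phi => /andP[? ?];
    by apply/andP; split; lra.
rewrite !lebesgue_measure_itv/= !lte_fin ltrD2l ltrN2.
by case: ifP => // _; rewrite -!EFinB; congr EFin; ring.
Qed.

Lemma cv_consE d (y : 'cV[R]_d.+1) : cv_cons (cv_uncons y) = y.
Proof.
apply/colP => i; case: (unliftP ord0 i) => [j ->|->].
  by rewrite cv_consS /= mxE; congr (y _ _); exact/val_inj.
by rewrite cv_cons0.
Qed.

Lemma cv_consB d (p q : R * 'cV[R]_d) :
  cv_cons p - cv_cons q = cv_cons (p.1 - q.1, p.2 - q.2).
Proof.
apply/colP => i; rewrite [LHS]mxE; case: (unliftP ord0 i) => [j ->|->].
  by rewrite [X in _ + X]mxE !cv_consS [RHS]mxE [X in _ = _ + X]mxE.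
by rewrite [X in _ + X]mxE !cv_cons0.
Qed.

Lemma measurable_cv_entry d (i : 'I_d) :
  measurable_fun [set: 'cV[R]_d] (fun y : 'cV[R]_d => y i ord0).
Proof. exact: (measurable_cv_coord i). Qed.

Lemma measurable_cvB d (a : 'cV[R]_d) :
  measurable_fun [set: 'cV[R]_d] (fun y : 'cV[R]_d => a - y).
Proof.
apply/measurable_fun_cvP => i.
rewrite (_ : _ \o _ = fun y : 'cV[R]_d => a i ord0 - y i ord0); last first.
  by apply/funext => y; rewrite /cv_coord /= !mxE.
by apply: measurable_funB => //; exact: measurable_cv_entry.
Qed.

(** Induction on the dimension, reflecting one coordinate at a time. This symmetry later yields both
    the vanishing of centred first moments and translation invariance for even kernels. *)
Lemma ge0_integral_cV_reflect d (a : 'cV[R]_d) (f : 'cV[R]_d -> \bar R) :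
  measurable_fun [set: 'cV[R]_d] f -> (forall y, 0 <= f y)%E ->
  (\int[lebesgue_cV d]_y f (a - y)%R = \int[lebesgue_cV d]_y f y)%E.
Proof.
elim: d a f => [|d IH] a f mf f0.
  rewrite !integral_cV0//; first by congr f; apply/colP => -[].
  exact: (measurableT_comp mf (measurable_cvB a)).
have mfr : measurable_fun [set: 'cV[R]_d.+1] (fun y => f (a - y)).
  exact: (measurableT_comp mf (measurable_cvB a)).
rewrite (ge0_integral_cVS mfr (fun y => f0 _)) (ge0_integral_cVS mf f0).
pose g x : \bar R := (\int[lebesgue_cV d]_z f (cv_cons (x, z)))%E.
have mg : measurable_fun [set: R] g.
  exact: measurable_integral_consl.
have g0 x : (0 <= g x)%E by exact: integral_ge0.
rewrite -[RHS](ge0_integral_reflect (cv_uncons a).1 mg g0).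
apply: eq_integral => x _; rewrite /g.
rewrite -[RHS](IH (cv_uncons a).2); last 2 first.
- exact: (measurableT_comp mf (measurable_cv_consl _)).
- by [].
apply: eq_integral => z _; congr f.
by rewrite -{1}(cv_consE a) cv_consB.
Qed.

Lemma linE d (w y : 'cV[R]_d) : lin w y = \sum_i w i ord0 * y i ord0.
Proof. by rewrite /lin mxE; apply: eq_bigr => i _; rewrite mxE. Qed.

Lemma measurable_lin d (w : 'cV[R]_d) : measurable_fun [set: 'cV[R]_d] (lin w).
Proof.
rewrite (_ : lin w = fun y => \sum_i w i ord0 * y i ord0); last first.
  by apply/funext => y; rewrite linE.
apply: measurable_sum => i.
by apply: measurable_funM => //; exact: measurable_cv_entry.
Qed.

Lemma lin_cons d (w : 'cV[R]_d.+1) x z :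
  lin w (cv_cons (x, z)) = w ord0 ord0 * x + lin (cv_uncons w).2 z.
Proof.
rewrite !linE big_ord_recl cv_cons0; congr (_ + _).
apply: eq_bigr => i _; rewrite cv_consS mxE; congr (w _ _ * _); exact/val_inj.
Qed.

(** * Slab estimate for isotropic normal densities *)

Definition iso_pdf d (s : R) (t : 'I_d -> R) (y : 'cV[R]_d) : R :=
  \prod_i normal_pdf (t i) s (y i ord0).

Lemma iso_pdf_ge0 d s (t : 'I_d -> R) y : 0 <= iso_pdf s t y.
Proof. by apply: prodr_ge0 => i _; exact: normal_pdf_ge0. Qed.

Lemma measurable_iso_pdf d s (t : 'I_d -> R) :
  measurable_fun [set: 'cV[R]_d] (iso_pdf s t).
Proof.
apply: measurable_prod => i _.
exact: (measurableT_comp (measurable_normal_pdf _ _) (measurable_cv_entry i)).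
Qed.

Lemma iso_pdf_cons d s (t : 'I_d.+1 -> R) x (z : 'cV[R]_d) :
  iso_pdf s t (cv_cons (x, z)) =
  normal_pdf (t ord0) s x * iso_pdf s (t \o lift ord0) z.
Proof.
rewrite /iso_pdf big_ord_recl cv_cons0; congr (_ * _).
by apply: eq_bigr => i _; rewrite cv_consS.
Qed.

Lemma integral_iso_pdf d s (t : 'I_d -> R) :
  (\int[lebesgue_cV d]_y (iso_pdf s t y)%:E = 1)%E.
Proof.
elim: d t => [|d IH] t.
  rewrite integral_cV0; first by rewrite /iso_pdf big_ord0.
  by apply/measurable_EFinP; exact: measurable_iso_pdf.
rewrite ge0_integral_cVS; last 2 first.
- by apply/measurable_EFinP; exact: measurable_iso_pdf.
- by move=> y; rewrite lee_fin iso_pdf_ge0.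
rewrite -[RHS](integral_normal_pdf (t ord0) s); apply: eq_integral => x _.
under eq_integral do rewrite iso_pdf_cons EFinM.
rewrite ge0_integralZl_EFin//; first by rewrite IH mule1.
- by move=> z _; rewrite lee_fin iso_pdf_ge0.
- by apply/measurable_EFinP; exact: measurable_iso_pdf.
- exact: normal_pdf_ge0.
Qed.

(** If the first coordinate of [w] is zero, the slab ignores that axis, which integrates out to 1,
    and induction applies. Otherwise each line along the first axis meets the slab in an interval of
    length [h / |w_0|], where the density is at most its peak. The constant depends on neither [t]
    nor [a]. *)
Lemma iso_pdf_slab d s (w : 'cV[R]_d) : s != 0 -> w != 0 ->
  exists2 C : R, 0 <= C & forall (t : 'I_d -> R) (a h : R), 0 <= h ->
  (\int[lebesgue_cV d]_y (iso_pdf s t y * \1_`[a, a + h] (lin w y))%:E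
   <= (C * h)%:E)%E.
Proof.
move=> s0; have mf n (u : 'cV[R]_n) t a h : measurable_fun [set: 'cV[R]_n]
    (fun y => (iso_pdf s t y * \1_`[a, a + h] (lin u y))%:E).
  apply/measurable_EFinP; apply: measurable_funM; first exact: measurable_iso_pdf.
  by apply: measurableT_comp => //; exact: measurable_lin.
have f0 n (u : 'cV[R]_n) t a h y :
    (0 <= (iso_pdf s t y * \1_`[a, a + h] (lin u y))%:E)%E.
  by rewrite lee_fin mulr_ge0// iso_pdf_ge0.
elim: d w => [w|d IH w w0].
  by move/eqP; case; apply/colP => -[].
have [w00|w00] := eqVneq (w ord0 ord0) 0.
  have [|C C0 HC] := IH (cv_uncons w).2.
    apply: contra_neq w0 => w'0; apply/colP => i; rewrite mxE.
    rewrite -(cv_consE w); case: (unliftP ord0 i) => [j ->|->].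
      by rewrite cv_consS w'0 mxE.
    by rewrite cv_cons0.
  exists C => // t a h h0; rewrite ge0_integral_cVS//.
  rewrite -[leRHS]mul1e -(integral_normal_pdf (t ord0) s).
  rewrite -ge0_integralZr//=; last 3 first.
  - by apply/measurable_EFinP; exact: measurable_normal_pdf.
  - by move=> x _; rewrite lee_fin normal_pdf_ge0.
  - by rewrite lee_fin mulr_ge0.
  apply: ge0_le_integral => //.
  - by move=> x _; exact: integral_ge0.
  - exact: (measurable_integral_consl (mf _ _ _ _ _)).
  - apply: emeasurable_funM => //.
    by apply/measurable_EFinP; exact: measurable_normal_pdf.
  move=> x _; under eq_integral do
    rewrite iso_pdf_cons lin_cons w00 mul0r add0r -mulrA EFinM.
  rewrite ge0_integralZl_EFin//; [|exact: mf|exact: normal_pdf_ge0].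
  by rewrite lee_pmul// ?HC// ?lee_fin ?normal_pdf_ge0//; exact: integral_ge0.
exists (normal_peak s / `|w ord0 ord0|).
  by rewrite divr_ge0// normal_peak_ge0.
move=> t a h h0; rewrite ge0_integral_cVS_swap//.
(* The factor 1 becomes the total mass of the density of the remaining coordinates, so that the two
   sides can be compared pointwise in [z]. *)
rewrite -[leRHS]mule1 -(integral_iso_pdf s (t \o lift ord0)).
rewrite -ge0_integralZl_EFin//=; last 3 first.
- by move=> x _; rewrite lee_fin iso_pdf_ge0.
- by apply/measurable_EFinP; exact: measurable_iso_pdf.
- by rewrite mulr_ge0// divr_ge0// normal_peak_ge0.
apply: ge0_le_integral => //.
- by move=> x _; exact: integral_ge0.
- exact: (measurable_integral_consr (mf _ _ _ _ _)).
- by apply: emeasurable_funM => //; apply/measurable_EFinP; exact: measurable_iso_pdf.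
move=> z _; under eq_integral do rewrite iso_pdf_cons lin_cons.
set v := w ord0 ord0 in w00 *; set c := lin _ z.
have v0 : 0 < `|v| by rewrite normr_gt0.
(* Left end of the interval of those [x] with [v * x + c] in [[a, a + h]]; a negative [v] reverses
   the order of the end points. *)
pose l := if 0 < v then (a - c) / v else (a + h - c) / v.
pose p := normal_peak s * iso_pdf s (t \o lift ord0) z.
have p0 : 0 <= p by rewrite mulr_ge0 ?iso_pdf_ge0 ?normal_peak_ge0.
have -> : ((normal_peak s / `|v| * h)%:E * (iso_pdf s (t \o lift ord0) z)%:E =
    \int[leb]_x (p%:E * (\1_`[l, l + h / `|v|] x)%:E))%E.
  rewrite ge0_integralZl_EFin//; last exact/measurable_EFinP.
  rewrite integral_indic//= setIT lebesgue_measure_itv/= lte_fin.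
  have [|] := ltP l (l + h / `|v|).
    by move=> _; rewrite -EFinB -!EFinM /p; congr EFin; ring.
  rewrite gerDl pmulr_lle0 ?invr_gt0// => h00.
  by have -> : h = 0 by [lra]; rewrite mulr0 mul0e mule0.
apply: ge0_le_integral => //.
- by move=> x _; rewrite lee_fin !mulr_ge0 ?normal_pdf_ge0 ?iso_pdf_ge0.
- apply/measurable_EFinP; apply: measurable_funM.
    apply: measurable_funM => //; exact: measurable_normal_pdf.
  by apply: measurableT_comp => //; exact: measurable_funD.
- by apply: emeasurable_funM => //; exact/measurable_EFinP.
move=> x _; rewrite -EFinM lee_fin /p mulrAC [leRHS]mulrAC.
rewrite ler_wpM2r ?iso_pdf_ge0// !indicE.
case: (boolP (v * x + c \in _)) => [|_]; last first.
  by rewrite mulr0 mulr_ge0 ?normal_peak_ge0.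
rewrite inE /= in_itv /= => /andP[ax xh].
rewrite mem_set /=; first by rewrite !mulr1 normal_pdf_ub.
rewrite in_itv /= /l; case: ltP => vs.
  rewrite gtr0_norm// -mulrDl ler_pdivrMr// ler_pdivlMr//.
  by apply/andP; split; lra.
have {}vs : v < 0 by rewrite lt_neqAle w00.
rewrite ltr0_norm// invrN mulrN -mulrBl ler_ndivrMr// ler_ndivlMr//.
by apply/andP; split; lra.
Qed.

(** * Cubes and positive volume of sets of directions *)

Lemma measurable_forall_ord disp (T : measurableType disp) n (F : 'I_n -> set T) :
  (forall i, measurable (F i)) -> measurable [set x | forall i, F i x].
Proof.
move=> mF; rewrite (_ : [set _ | _] = \bigcap_(i in [set: 'I_n]) F i).
  by apply: fin_bigcap_measurable => // i _; exact: mF.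
by apply/seteqP; split => x /= h i; [move=> _; exact: h|exact: (h i Logic.I)].
Qed.

Definition cv_box d (c : 'I_d -> R) e : set 'cV[R]_d :=
  [set y | forall i, `]c i - e, c i + e[%classic (y i ord0)].

Lemma measurable_cv_box d (c : 'I_d -> R) e : measurable (cv_box c e).
Proof.
apply: measurable_forall_ord => i; rewrite -[X in measurable X]setTI.
exact: measurable_cv_entry.
Qed.

Lemma lebesgue_cv_box_gt0 d (c : 'I_d -> R) e :
  0 < e -> (0 < lebesgue_cV d (cv_box c e))%E.
Proof.
move=> e0; elim: d c => [|d IH] c.
  by rewrite /= diracE mem_set ?lte01// => -[].
have -> : lebesgue_cV d.+1 (cv_box c e) =
    (leb \x lebesgue_cV d)%E (@cv_cons R d @^-1` cv_box c e) by [].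
have -> : @cv_cons R d @^-1` cv_box c e =
    `]c ord0 - e, c ord0 + e[%classic `*` cv_box (c \o lift ord0) e.
  apply/seteqP; split => [[x z] /= h|[x z] /= [hx hz] i].
    split=> [|i]; first by have := h ord0; rewrite cv_cons0.
    by have := h (lift ord0 i); rewrite cv_consS.
  case: (unliftP ord0 i) => [j ->|->]; first by rewrite cv_consS; exact: hz.
  by rewrite cv_cons0.
rewrite product_measure1E//; last exact: measurable_cv_box.
apply: mule_gt0 => //=; rewrite lebesgue_measure_itv/= lte_fin.
by rewrite ltrD2l gt0_cp// -EFinB lte_fin; lra.
Qed.

Lemma linC d (x y : 'cV[R]_d) : lin x y = lin y x.
Proof. by rewrite !linE; apply: eq_bigr => i _; rewrite mulrC. Qed.

Lemma measurable_halfspaces d (a b : 'cV[R]_d) :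
  measurable [set lam : 'cV[R]_d | 0 < lin lam a * lin lam b].
Proof.
rewrite -[X in measurable X]setTI.
rewrite (_ : [set _ | _] =
  (fun lam : 'cV[R]_d => lin a lam * lin b lam) @^-1` `]0, +oo[%classic).
  by apply: measurable_funM => //; exact: measurable_lin.
by apply/seteqP; split => lam /=; rewrite in_itv/= andbT ![lin lam _]linC.
Qed.

(** For the sup norm, [lin _ c] is Lipschitz with constant the sum of the [|c_i|], so both forms
    stay positive on a small cube around [lam0], and cubes have positive volume. *)
Lemma halfspaces_gt0 d (a b lam0 : 'cV[R]_d) :
  0 < lin lam0 a -> 0 < lin lam0 b ->
  (0 < lebesgue_cV d [set lam | (0 < lin lam a * lin lam b)%R])%E.
Proof.
have lin_box (c lam : 'cV[R]_d) e : 0 <= e ->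
    cv_box (fun i => lam0 i ord0) e lam ->
    `|lin lam c - lin lam0 c| <= e * \sum_i `|c i ord0|.
  move=> e0 h; rewrite !linE -sumrB mulr_sumr.
  apply: le_trans (ler_norm_sum _ _ _) _; apply: ler_sum => i _.
  rewrite -mulrBl normrM ler_wpM2r// ler_norml.
  by have := h i; rewrite /= in_itv/= => /andP[? ?]; apply/andP; split; lra.
(* Over a cube of radius [e1] the form moves by at most [e1] times the Lipschitz constant; the added
   1 makes this strictly less than [lin lam0 a] and keeps the denominator positive. *)
move=> la lb; pose e1 := lin lam0 a / (1 + \sum_i `|a i ord0|).
pose e2 := lin lam0 b / (1 + \sum_i `|b i ord0|).
have sum0 (c : 'cV[R]_d) : 0 <= \sum_i `|c i ord0| by exact: sumr_ge0.
have e10 : 0 < e1 by rewrite divr_gt0// ltr_pwDl.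
have e20 : 0 < e2 by rewrite divr_gt0// ltr_pwDl.
have e0 : 0 < Num.min e1 e2 by rewrite lt_min e10.
apply: (lt_le_trans (lebesgue_cv_box_gt0 (fun i => lam0 i ord0) e0)).
have lt_box (c lam : 'cV[R]_d) : 0 < lin lam0 c ->
    Num.min e1 e2 <= lin lam0 c / (1 + \sum_i `|c i ord0|) ->
    cv_box (fun i => lam0 i ord0) (Num.min e1 e2) lam -> 0 < lin lam c.
  move=> c0 le /(lin_box c _ _ (ltW e0)).
  rewrite ler_pdivlMr ?ltr_pwDl// in le.
  by rewrite ler_norml => /andP[+ _]; move: le; rewrite mulrDr mulr1; lra.
apply: le_measure; rewrite ?inE.
- exact: measurable_cv_box.
- exact: measurable_halfspaces.
move=> lam h /=; rewrite mulr_gt0//.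
- by apply: lt_box h => //; rewrite ge_min lexx.
- by apply: lt_box h => //; rewrite ge_min lexx orbT.
Qed.

End lebesgue_cV_integral.

(** * Positive definite matrices *)

Section quadratic_form.
Context {R : realType} {d : nat}.
Implicit Types (A B : 'M[R]_d) (x y z : 'cV[R]_d).

Definition bform A x y : R := (x^T *m A *m y) 0 0.

Lemma bformDl A x y z : bform A (x + y) z = bform A x z + bform A y z.
Proof. by rewrite /bform linearD /= !mulmxDl mxE. Qed.

Lemma bformDr A x y z : bform A x (y + z) = bform A x y + bform A x z.
Proof. by rewrite /bform mulmxDr mxE. Qed.

Lemma bformZl A c x y : bform A (c *: x) y = c * bform A x y.
Proof. by rewrite /bform linearZ /= -!scalemxAl mxE. Qed.

Lemma bformZr A c x y : bform A x (c *: y) = c * bform A x y.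
Proof. by rewrite /bform -scalemxAr mxE. Qed.

Lemma bformNl A x y : bform A (- x) y = - bform A x y.
Proof. by rewrite -scaleN1r bformZl mulN1r. Qed.

Lemma bformNr A x y : bform A x (- y) = - bform A x y.
Proof. by rewrite -scaleN1r bformZr mulN1r. Qed.

Lemma bform_lin A x y : bform A x y = lin x (A *m y).
Proof. by rewrite /bform /lin mulmxA. Qed.

Lemma bformMDl A B x y : bform (A + B) x y = bform A x y + bform B x y.
Proof. by rewrite /bform mulmxDr mulmxDl mxE. Qed.

Lemma bformMZl c A x y : bform (c *: A) x y = c * bform A x y.
Proof. by rewrite /bform -scalemxAr -scalemxAl mxE. Qed.

Lemma bformC A x y : A^T = A -> bform A x y = bform A y x.
Proof.
move=> sA; rewrite /bform -[LHS]/((x^T *m A *m y) 0 0).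
have -> : x^T *m A *m y = (y^T *m A *m x)^T.
  by rewrite !trmx_mul trmxK sA mulmxA.
by rewrite mxE.
Qed.

Lemma posdefmx_bform_ge0 A x : posdefmx A -> 0 <= bform A x x.
Proof.
move=> [_ pA]; have [->|/pA/ltW//] := eqVneq x 0.
by rewrite /bform mulmx0 mxE.
Qed.

Lemma posdefmx_unit A : posdefmx A -> A \in unitmx.
Proof.
move=> [_ pA]; rewrite unitmxE unitfE; apply/negP => /det0P[v v0 vA].
have := pA v^T; rewrite trmxK vA mul0mx mxE ltxx => h; apply: notF; apply: h.
by apply: contra_neq v0 => /(congr1 trmx); rewrite trmxK trmx0.
Qed.

(** The form of [invmx A] at [x] is the form of [A] at [invmx A *m x]. *)
Lemma posdefmx_inv A : posdefmx A -> posdefmx (invmx A).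
Proof.
move=> pA; have uA := posdefmx_unit pA; case: (pA) => sA pA'; split.
  by rewrite trmx_inv sA.
move=> x x0; have := pA' (invmx A *m x).
rewrite trmx_mul trmx_inv sA mulmxKV// mulmxA; apply.
by apply: contra_neq x0 => /(congr1 (mulmx A)); rewrite mulKVmx// mulmx0.
Qed.

Lemma posdefmxD A B : posdefmx A -> posdefmx B -> posdefmx (A + B).
Proof.
move=> [sA pA] [sB pB]; split; first by rewrite linearD/= sA sB.
move=> x x0; rewrite -/(bform _ _ _) bformMDl.
by apply: addr_gt0; [exact: pA|exact: pB].
Qed.

Lemma posdefmxZ c A : 0 < c -> posdefmx A -> posdefmx (c *: A).
Proof.
move=> c0 [sA pA]; split; first by rewrite linearZ/= sA.
by move=> x x0; rewrite -/(bform _ _ _) bformMZl mulr_gt0//; exact: pA.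
Qed.

Lemma posdefmx1 : posdefmx (1%:M : 'M[R]_d).
Proof.
split; first by rewrite trmx1.
move=> x x0; rewrite mulmx1 -/(lin x x) linE.
have /cV0Pn[i xi] : x != 0 by [].
rewrite (bigD1 i)//= ltr_pwDl//; last by apply: sumr_ge0 => j _; rewrite -expr2 sqr_ge0.
by rewrite -expr2 exprn_even_gt0.
Qed.

(* The determinant does not vanish along the segment from A to the identity. *)
Lemma posdefmx_det_gt0 A : posdefmx A -> 0 < \det A.
Proof.
move=> pA; rewrite lt_neqAle eq_sym -unitfE -unitmxE posdefmx_unit//=.
rewrite leNgt; apply/negP => detA.
(* As a polynomial in the segment parameter, the determinant obeys the intermediate value theorem: a
   sign change would produce a singular matrix on the segment, yet convex combinations of positive
   definite matrices are invertible. *)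
pose p : {poly R} := \det (map_mx polyC A + 'X *: map_mx polyC (1%:M - A)).
have pE t : p.[t] = \det (A + t *: (1%:M - A)).
  rewrite /p -[LHS]/(horner_eval t _) -det_map_mx; congr (\det _).
  by apply/matrixP => i j; rewrite !mxE /= horner_evalE !hornerE.
have [||t /andP[t0 t1]] := @poly_ivt R p 0 1; first exact: ler01.
  rewrite !pE scale0r addr0 scale1r subrKC det1 ler01 andbT; exact: ltW.
rewrite /root pE => /eqP dt.
suff /posdefmx_unit : posdefmx (A + t *: (1%:M - A)) by rewrite unitmxE dt unitr0.
have [->|t00] := eqVneq t 0; first by rewrite scale0r addr0.
have [->|t11] := eqVneq t 1; first by rewrite scale1r subrKC; exact: posdefmx1.
rewrite scalerBr addrCA -[X in _ + (X - _)]scale1r -scalerBl.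
by apply: posdefmxD; apply: posdefmxZ;
  rewrite ?subr_gt0 ?lt_neqAle ?(eq_sym 0) ?t00 ?t11//; exact: posdefmx1.
Qed.

Lemma bform_cauchy_schwarz A x y : posdefmx A ->
  bform A x y ^+ 2 <= bform A x x * bform A y y.
Proof.
move=> pA; have [->|x0] := eqVneq x 0.
  by rewrite -[0](scale0r 0) !bformZl !mul0r expr0n.
have a0 : 0 < bform A x x by exact: pA.2.
(* The form at this vector equals [bform A x x] times the difference of the two sides of the
   claim. *)
have := posdefmx_bform_ge0 (bform A x x *: y - bform A x y *: x) pA.
rewrite !(bformDl, bformDr, bformNl, bformNr, bformZl, bformZr).
rewrite (bformC y x pA.1) => h.
rewrite -(ler_pM2l a0) -subr_ge0; apply: le_trans h _.
by rewrite le_eqVlt; apply/orP; left; apply/eqP; ring.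
Qed.

(** The coordinate [x_i] is the pairing of [x] with [u], the image of the i-th basis vector under
    [invmx A]. Cauchy-Schwarz applies, and the form at [u] is the i-th diagonal entry of
    [invmx A]. *)
Lemma sqr_entry_le_bform A x i : posdefmx A ->
  x i 0 ^+ 2 <= invmx A i i * bform A x x.
Proof.
move=> pA; have uA := posdefmx_unit pA.
have sAi : (invmx A)^T = invmx A by rewrite trmx_inv pA.1.
pose u : 'cV[R]_d := invmx A *m delta_mx i 0.
have uAx y : bform A u y = y i 0.
  rewrite /bform /u trmx_mul sAi mulmxKV// trmx_delta.
  by rewrite -rowE mxE.
have := bform_cauchy_schwarz u x pA; rewrite !uAx.
by rewrite /u -colE mxE.
Qed.

Lemma norm2_le_bform A : posdefmx A ->
  exists2 T, 0 < T & forall x, \sum_i x i 0 ^+ 2 <= T * bform A x x.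
Proof.
(* The trace of the inverse comes from summing the coordinate bounds; the added 1 makes the constant
   positive in every dimension. *)
move=> pA; exists (1 + \sum_i invmx A i i).
  rewrite ltr_pwDl// sumr_ge0// => i _.
  have := posdefmx_bform_ge0 (delta_mx i 0) (posdefmx_inv pA).
  by rewrite /bform -mulmxA -colE trmx_delta -rowE !mxE.
move=> x; rewrite mulrDl mul1r mulr_suml.
apply: ler_wpDl; first exact: posdefmx_bform_ge0.
by apply: ler_sum => i _; exact: sqr_entry_le_bform.
Qed.

End quadratic_form.

(** * Gaussian kernels and the posterior mean *)

Section gaussian_kernel.
Context {R : realType} {d : nat}.
Implicit Types (Q : 'M[R]_d) (m y t : 'cV[R]_d).
Local Notation leb := (lebesgue_cV d : set 'cV[R]_d -> \bar R).

(** Unnormalised Gaussian with centre [m]; [Q] is the precision matrix, not the covariance. *)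
Definition gker m Q y : R := expR (- bform Q (y - m) (y - m) / 2).

Lemma gker_gt0 m Q y : 0 < gker m Q y. Proof. exact: expR_gt0. Qed.

Lemma gker_reflect m Q y : gker m Q (m + m - y) = gker m Q y.
Proof.
by rewrite /gker (_ : m + m - y - m = - (y - m)) ?bformNl ?bformNr ?opprK//
  opprB addrAC addrK.
Qed.

Lemma iso_pdfE s (m : 'I_d -> R) y : s != 0 ->
  iso_pdf s m y =
  normal_peak s ^+ d * expR (- (\sum_i (y i ord0 - m i) ^+ 2) / (s ^+ 2 *+ 2)).
Proof.
move=> s0; rewrite /iso_pdf; under eq_bigr do rewrite normal_pdfE//.
rewrite big_split/= prodr_const card_ord; congr (_ * _).
by rewrite mulNr mulr_suml -sumrN expR_sum; apply: eq_bigr => i _; rewrite -mulNr.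
Qed.

(** Coercivity bounds the kernel by the square of [expR (- S / (4T))], where [S] is the squared
    distance to [m]. One factor is the shape of an isotropic normal density of variance [2T]; the
    other absorbs the linear factor of a first moment. Neither [s] nor [C] depends on [m]. *)
Lemma gker_le_iso_pdf Q : posdefmx Q -> exists s C : R,
  [/\ s != 0, 0 <= C & forall m y,
    gker m Q y <= C * iso_pdf s (fun i => m i 0) y /\
    forall k, `|y k 0 - m k 0| * gker m Q y <= C * iso_pdf s (fun i => m i 0) y].
Proof.
move=> /norm2_le_bform[T T0 HT]; pose s := Num.sqrt (2 * T); exists s.
have s0 : s != 0 by rewrite gt_eqF// sqrtr_gt0 mulr_gt0.
have s2 : s ^+ 2 = 2 * T by rewrite sqr_sqrtr// mulr_ge0// ltW.
(* With [r = |y_k - m_k|], the chain [r <= 1 + r^2 <= 1 + S <= K * (1 + S / (4T)) <= K * expR (S /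
   (4T))] yields the moment bound. *)
pose K := 1 + 4 * T; have K1 : 1 <= K by rewrite lerDl mulr_ge0// ltW.
have pk := normal_peak_gt0 s0.
have pkd : 0 < normal_peak s ^+ d by rewrite exprn_gt0.
exists (K / normal_peak s ^+ d); split => // [|m y].
  by rewrite divr_ge0// ltW// (lt_le_trans ltr01).
rewrite iso_pdfE// mulrA divfK ?gt_eqF// s2.
set S := \sum_i _; have S0 : 0 <= S by apply: sumr_ge0 => i _; exact: sqr_ge0.
have SQ : S <= T * bform Q (y - m) (y - m).
  apply: le_trans (HT _); rewrite le_eqVlt; apply/orP; left; apply/eqP.
  by apply: eq_bigr => i _; rewrite !mxE.
have le1 : gker m Q y <= expR (- (S / (4 * T))) * expR (- (S / (4 * T))).
  rewrite /gker -expRD ler_expR -mulNr -mulrDl ler_pdivlMr ?mulr_gt0//.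
  by rewrite mulrACA; nra.
have -> : - S / (2 * T *+ 2) = - (S / (4 * T)).
  by rewrite mulNr -mulr_natr; congr (- (S / _)); ring.
have e1 : expR (- (S / (4 * T))) <= 1.
  by rewrite -[leRHS]expR0 ler_expR oppr_le0 divr_ge0// mulr_ge0// ltW.
have e0 := expR_ge0 (- (S / (4 * T))).
split=> [|k].
  by apply: le_trans le1 _; nra.
apply: le_trans (ler_wpM2l (normr_ge0 _) le1) _.
rewrite mulrA ler_wpM2r//.
rewrite expRN ler_pdivrMr ?expR_gt0//.
have Sk : `|y k 0 - m k 0| ^+ 2 <= S.
  rewrite real_normK ?num_real// /S (bigD1 k)//= lerDl.
  by apply: sumr_ge0 => i _; exact: sqr_ge0.
apply: (@le_trans _ _ (K * (1 + S / (4 * T)))); last first.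
  by rewrite ler_wpM2l ?expR_ge1Dx// (le_trans ler01).
have ST : S / (4 * T) * (4 * T) = S by rewrite divfK// gt_eqF// mulr_gt0.
have ST0 : 0 <= S / (4 * T) by rewrite divr_ge0// mulr_ge0// ltW.
rewrite /K mulrDl mul1r mulrDr mulr1 [4 * T * (_ / _)]mulrC ST.
have : 0 <= (`|y k 0 - m k 0| - 1) ^+ 2 by exact: sqr_ge0.
by rewrite sqrrB mulr1 expr1n; have := normr_ge0 (y k 0 - m k 0); lra.
Qed.

Lemma measurable_gker m Q : measurable_fun [set: 'cV[R]_d] (gker m Q).
Proof.
apply: measurableT_comp => //; apply: measurable_funM => //.
apply: measurableT_comp => //.
rewrite (_ : (fun y => _) = fun y : 'cV[R]_d =>
    \sum_j \sum_i (y i 0 - m i 0) * Q i j * (y j 0 - m j 0)); last first.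
  apply/funext => y; rewrite /bform mxE; apply: eq_bigr => j _.
  by rewrite !mxE mulr_suml; apply: eq_bigr => i _; rewrite !mxE.
apply: measurable_sum => j; apply: measurable_sum => i.
apply: measurable_funM; last first.
  by apply: measurable_funB => //; exact: measurable_cv_entry.
apply: measurable_funM => //.
by apply: measurable_funB => //; exact: measurable_cv_entry.
Qed.

Lemma measurable_entryB m k : measurable_fun [set: 'cV[R]_d] (fun y => y k 0 - m k 0).
Proof. by apply: measurable_funB => //; exact: measurable_cv_entry. Qed.

Lemma integrable_iso_pdf s (t : 'I_d -> R) (C : R) :
  (lebesgue_cV d).-integrable [set: 'cV[R]_d] (fun y => (C * iso_pdf s t y)%:E).
Proof.
apply: (@integrableZl _ _ _ _ _ _ C (fun y => (iso_pdf s t y)%:E)) => //.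
apply/integrableP; split.
  by apply/measurable_EFinP; exact: measurable_iso_pdf.
under eq_integral do rewrite gee0_abs ?lee_fin ?iso_pdf_ge0//.
by rewrite integral_iso_pdf ltry.
Qed.

Lemma integrable_gker m Q : posdefmx Q ->
  (lebesgue_cV d).-integrable [set: 'cV[R]_d] (fun y => (gker m Q y)%:E).
Proof.
move=> /gker_le_iso_pdf[s [C [s0 C0 H]]].
apply: le_integrable (integrable_iso_pdf s (fun i => m i 0) C) => //.
  by apply/measurable_EFinP; exact: measurable_gker.
move=> y _; rewrite !gee0_abs ?lee_fin; last exact: ltW (gker_gt0 _ _ _).
  exact: (H m y).1.
by rewrite mulr_ge0// iso_pdf_ge0.
Qed.

Lemma integrable_gker_moment m Q k : posdefmx Q ->
  (lebesgue_cV d).-integrable [set: 'cV[R]_d]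
    (fun y => ((y k 0 - m k 0) * gker m Q y)%:E).
Proof.
move=> /gker_le_iso_pdf[s [C [s0 C0 H]]].
apply: le_integrable (integrable_iso_pdf s (fun i => m i 0) C) => //.
  apply/measurable_EFinP; apply: measurable_funM; last exact: measurable_gker.
  exact: measurable_entryB.
move=> y _; rewrite /= !lee_fin normrM (gtr0_norm (gker_gt0 _ _ _)).
rewrite [leRHS]ger0_norm; first exact: (H m y).2.
by rewrite mulr_ge0// iso_pdf_ge0.
Qed.

(** Reflection about [m] fixes the kernel and negates the linear factor, so the positive and
    negative parts have equal integrals. *)
Lemma Rintegral_gker_moment m Q k :
  (\int[lebesgue_cV d]_y ((y k 0 - m k 0) * gker m Q y)) = 0.
Proof.
rewrite /Rintegral integralE.
set f := (fun y : 'cV[R]_d => _%:E).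
have mf : measurable_fun [set: 'cV[R]_d] f.
  apply/measurable_EFinP; apply: measurable_funM; last exact: measurable_gker.
  exact: measurable_entryB.
have -> : (\int[lebesgue_cV d]_y f^\- y = \int[lebesgue_cV d]_y f^\+ y)%E.
  rewrite -[RHS](ge0_integral_cV_reflect (m + m))//; last exact: measurable_funepos.
  apply: eq_integral => y _; rewrite funeposE funenegE /f gker_reflect.
  congr maxe; rewrite -EFinN; congr EFin; rewrite -mulNr; congr (_ * _).
  by rewrite !mxE; ring.
(* Were the common value infinite, its difference with itself would be an infinite extended real,
   which [fine] sends to 0. *)
by case: (\int[_]_y _)%E => [r| |] //=; rewrite ?subrr.
Qed.

(** Otherwise a probability density would integrate to 0. *)
Lemma lebesgue_cVT_neq0 : leb setT != 0%E.
Proof.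
apply/eqP => l0; have : ((0 : R)%:E = 1%:E)%E; last first.
  by move=> [] /eqP; rewrite eq_sym oner_eq0.
rewrite -(integral_iso_pdf 1 (fun _ : 'I_d => 0)); apply/esym.
apply: null_set_integral => //.
by apply/measurable_EFinP; exact: measurable_iso_pdf.
Qed.

Definition gker_mass Q : R := \int[lebesgue_cV d]_y gker 0 Q y.

(** Since the form is even, the reflection [y -> m - y] turns the kernel centred at 0 into the one
    centred at [m] and does the work of a translation. *)
Lemma integral_gker m Q : posdefmx Q ->
  (\int[lebesgue_cV d]_y (gker m Q y)%:E = (gker_mass Q)%:E)%E.
Proof.
move=> pQ; rewrite /gker_mass /Rintegral fineK; last first.
  by apply: integrable_fin_num => //; exact: integrable_gker.
have mg : measurable_fun [set: 'cV[R]_d] (fun y => (gker 0 Q y)%:E).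
  by apply/measurable_EFinP; exact: measurable_gker.
have g0 y : (0 <= (gker 0 Q y)%:E)%E by rewrite lee_fin ltW// gker_gt0.
rewrite -[RHS](ge0_integral_cV_reflect m mg g0).
apply: eq_integral => y _; congr EFin.
by rewrite /gker subr0 -(opprB m y) bformNl bformNr opprK.
Qed.

(** A vanishing integral would make the kernel zero almost everywhere; as it is positive everywhere,
    the whole space would be null. *)
Lemma gker_mass_gt0 Q : posdefmx Q -> 0 < gker_mass Q.
Proof.
move=> pQ; rewrite -lte_fin -(integral_gker 0)// lt_neqAle.
apply/andP; split; last by apply: integral_ge0 => y _; rewrite lee_fin ltW// gker_gt0.
apply/eqP => i0; apply/negP: lebesgue_cVT_neq0; apply/negPn/eqP.
have mg : measurable_fun [set: 'cV[R]_d] (fun y => (gker 0 Q y)%:E).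
  by apply/measurable_EFinP; exact: measurable_gker.
have /(ae_eq_integral_abs _ measurableT mg) :
    (\int[lebesgue_cV d]_y `|(gker 0 Q y)%:E| = 0)%E.
  rewrite [RHS]i0; apply: eq_integral => y _.
  by rewrite gee0_abs// lee_fin ltW// gker_gt0.
move=> h; apply: (measure_negligible measurableT).
apply: negligibleS h => y _ /= /(_ Logic.I) [].
by apply/eqP; rewrite gt_eqF// gker_gt0.
Qed.

End gaussian_kernel.

(** * The posterior as a Gaussian kernel, and its mean *)

Section posterior.
Context {R : realType} {d n : nat}.
Implicit Types (A B S L : 'M[R]_d) (m mu t : 'cV[R]_d) (y : 'I_n -> 'cV[R]_d).

Definition gauss_const S : R := (Num.sqrt ((2 * pi) ^+ d * \det S))^-1.

Lemma gauss_const_gt0 S : posdefmx S -> 0 < gauss_const S.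
Proof.
move=> pS; rewrite invr_gt0 sqrtr_gt0 mulr_gt0 ?posdefmx_det_gt0//.
by rewrite exprn_gt0// mulr_gt0// pi_gt0.
Qed.

Lemma gauss_pdfE mu S t : gauss_pdf mu S t = gauss_const S * gker mu (invmx S) t.
Proof. by []. Qed.

Lemma bform_sumr B t y : bform B t (\sum_i y i) = \sum_i bform B t (y i).
Proof. by rewrite /bform mulmx_sumr summxE. Qed.

Lemma bform_sqrD A s t : A^T = A ->
  bform A (s + t) (s + t) = bform A s s + 2 * bform A s t + bform A t t.
Proof. by move=> sA; rewrite bformDl !bformDr (bformC t s sA); ring. Qed.

Lemma bform_sqrB A s t : A^T = A ->
  bform A (s - t) (s - t) = bform A s s - 2 * bform A t s + bform A t t.
Proof.
by move=> sA; rewrite bform_sqrD// !(bformNl, bformNr) opprK (bformC s t sA); ring.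
Qed.

(** Expand both quadratic terms in [s = t - m]; the equation for [m] is exactly the cancellation of
    the terms linear in [s]. *)
Lemma complete_square A B m mu y t : A^T = A -> B^T = B ->
  (A + n%:R *: B) *m m = A *m mu + B *m \sum_i y i ->
  bform A (t - mu) (t - mu) + \sum_i bform B (y i - t) (y i - t) =
  bform A (m - mu) (m - mu) + \sum_i bform B (y i - m) (y i - m) +
  bform (A + n%:R *: B) (t - m) (t - m).
Proof.
move=> sA sB mE; pose s := t - m.
have -> : t - mu = s + (m - mu) by rewrite /s addrA subrK.
have yE i : bform B (y i - t) (y i - t) =
    bform B (y i - m) (y i - m) - 2 * bform B s (y i - m) + bform B s s.
  have -> : y i - t = (y i - m) - s by rewrite /s opprB addrA subrK.
  by rewrite bform_sqrB.
under eq_bigr do rewrite yE.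
rewrite big_split/= [in LHS]big_split/= sumrN -mulr_sumr sumr_const card_ord.
rewrite -bform_sumr big_split/= sumr_const card_ord.
rewrite bform_sqrD//.
rewrite bformMDl bformMZl -[t - m]/s.
(* The linear terms coming from the prior and from the likelihood agree, and they enter with
   opposite signs. *)
suff lin0 : bform A s (m - mu) = bform B s (\sum_i y i + (- m) *+ n).
  by rewrite -lin0 -[bform B s s *+ n]mulr_natl; ring.
rewrite !bform_lin; congr lin.
rewrite mulmxBr mulmxDr -scaler_nat -scalemxAr mulmxN scalerN.
move: mE; rewrite mulmxDl -scalemxAl => mE.
apply/eqP; rewrite subr_eq addrAC eq_sym subr_eq; apply/eqP.
by rewrite mE addrC.
Qed.

Variables (S L : 'M[R]_d) (mu : 'cV[R]_d).
Hypotheses (pS : posdefmx S) (pL : posdefmx L).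

Let Q := invmx S + n%:R *: invmx L.

Let pQ : posdefmx Q.
Proof.
have [n0|n0] := posnP n.
  by rewrite /Q n0 scale0r addr0; exact: posdefmx_inv.
apply: posdefmxD; first exact: posdefmx_inv.
by apply: posdefmxZ; [rewrite ltr0n|exact: posdefmx_inv].
Qed.

Lemma posterior_unnormalized y m :
  Q *m m = invmx S *m mu + invmx L *m \sum_i y i ->
  exists2 K, 0 < K & forall t,
    gauss_pdf mu S t * likelihood L y t = K * gker m Q t.
Proof.
(* The constant is the value at the centre [m], where the kernel equals 1. *)
move=> mE; exists (gauss_pdf mu S m * likelihood L y m).
  rewrite gauss_pdfE mulr_gt0 ?mulr_gt0 ?gauss_const_gt0 ?gker_gt0//.
  by apply: prodr_gt0 => i _; rewrite gauss_pdfE mulr_gt0 ?gauss_const_gt0 ?gker_gt0.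
have E t : gauss_pdf mu S t * likelihood L y t =
    gauss_const S * gauss_const L ^+ n *
    expR (- (bform (invmx S) (t - mu) (t - mu) +
             \sum_i bform (invmx L) (y i - t) (y i - t)) / 2).
  rewrite /likelihood gauss_pdfE; under eq_bigr do rewrite gauss_pdfE.
  rewrite big_split/= prodr_const card_ord mulrACA; congr (_ * _).
  rewrite /gker -expR_sum -expRD; congr expR.
  by rewrite opprD mulrDl; congr (_ + _); rewrite -sumrN mulr_suml.
move=> t; rewrite !E -[RHS]mulrA; congr (_ * _).
rewrite -expRD; congr expR.
rewrite (complete_square _ (posdefmx_inv pS).1 (posdefmx_inv pL).1 mE).
by rewrite -mulrDl -opprD.
Qed.

(** The factor [K] cancels between numerator and normalising integral, which leaves the mean of a
    normalised kernel centred at the solution [m]. *)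
Lemma posterior_meanP y :
  Q *m posterior_mean mu S L y = invmx S *m mu + invmx L *m \sum_i y i.
Proof.
pose m := invmx Q *m (invmx S *m mu + invmx L *m \sum_i y i).
have mE : Q *m m = invmx S *m mu + invmx L *m \sum_i y i.
  by rewrite /m mulKVmx// posdefmx_unit.
move: m mE => m mE; have [K K0 HK] := posterior_unnormalized mE.
suff -> : posterior_mean mu S L y = m by [].
have Z0 := gker_mass_gt0 pQ.
have i2 : (lebesgue_cV d).-integrable [set: 'cV[R]_d] (EFin \o gker m Q).
  exact: integrable_gker.
have RZ : \int[lebesgue_cV d]_t gker m Q t = gker_mass Q.
  by rewrite /Rintegral integral_gker.
have RKZ : \int[lebesgue_cV d]_t (gauss_pdf mu S t * likelihood L y t) =
    K * gker_mass Q.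
  under eq_Rintegral do rewrite HK.
  by rewrite (RintegralZl K measurableT i2) RZ.
apply/colP => k; rewrite mxE.
have i1 : (lebesgue_cV d).-integrable [set: 'cV[R]_d]
    (EFin \o (fun t => (t k 0 - m k 0) * gker m Q t)).
  exact: integrable_gker_moment.
(* Split [t_k] into [t_k - m_k], whose moment vanishes, and the constant [m_k]. *)
transitivity (\int[lebesgue_cV d]_t ((gker_mass Q)^-1 *
    ((t k ord0 - m k 0) * gker m Q t + m k 0 * gker m Q t))).
  apply: eq_Rintegral => t _; rewrite /posterior_pdf RKZ HK.
  rewrite invfM; field.
  by rewrite !gt_eqF.
have i3 : (lebesgue_cV d).-integrable [set: 'cV[R]_d]
    (EFin \o (fun t => m k 0 * gker m Q t)).
  exact: (@integrableZl _ _ _ _ _ _ (m k 0) (fun t => (gker m Q t)%:E)).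
rewrite (RintegralZl _ measurableT (integrableD measurableT i1 i3)).
rewrite (RintegralD measurableT i1 i3) Rintegral_gker_moment add0r.
rewrite (RintegralZl _ measurableT i2) RZ.
by rewrite mulrC (mulfK (lt0r_neq0 Z0)).
Qed.

End posterior.

(** * Hyperplanes are null for the sum of the observations *)

Section sampling.
Context {R : realType} {d : nat} (L : 'M[R]_d).
Hypothesis pL : posdefmx L.

Let pQ : posdefmx (invmx L) := posdefmx_inv pL.

(** This is a partial integral of a jointly measurable function of mean and point; it allows
    integration against the law of [theta]. *)
Lemma measurable_gauss (B : set 'cV[R]_d) : measurable B ->
  measurable_fun [set: 'cV[R]_d] (fun t => gauss t L B).
Proof.
move=> mB; pose f (p : 'cV[R]_d * 'cV[R]_d) : \bar R :=
  (gauss_const L * gker p.1 (invmx L) p.2 * \1_B p.2)%:E.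
rewrite (_ : (fun t => _) = fubini_F (lebesgue_cV d) f); last first.
  apply/funext => t; rewrite /gauss integral_mkcond; apply: eq_integral => y _.
  rewrite patchE /f /= indicE gauss_pdfE.
  by case: (y \in B); rewrite ?mulr1 ?mulr0.
apply: measurable_fun_fubini_tonelli_F; last first.
  move=> p; rewrite lee_fin mulr_ge0// mulr_ge0 ?(ltW (gker_gt0 _ _ _))//.
  exact: ltW (gauss_const_gt0 pL).
apply/measurable_EFinP; apply: measurable_funM; last first.
  by apply: (@measurableT_comp _ _ _ _ _ _ (\1_B : 'cV[R]_d -> R) _ snd) => //;
    exact: measurable_indic.
apply: measurable_funM => //; apply: measurableT_comp => //.
apply: measurable_funM => //; apply: measurableT_comp => //.
rewrite (_ : (fun y => _) = fun p : 'cV[R]_d * 'cV[R]_d =>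
    \sum_j \sum_i (p.2 i 0 - p.1 i 0) * invmx L i j * (p.2 j 0 - p.1 j 0)); last first.
  apply/funext => y; rewrite /bform mxE; apply: eq_bigr => j _.
  by rewrite !mxE mulr_suml; apply: eq_bigr => i _; rewrite !mxE.
have mB1 i : measurable_fun [set: 'cV[R]_d * 'cV[R]_d] (fun p => p.2 i 0 - p.1 i 0).
  apply: measurable_funB.
    exact: (measurableT_comp (measurable_cv_entry i) measurable_snd).
  exact: (measurableT_comp (measurable_cv_entry i) measurable_fst).
apply: measurable_sum => j; apply: measurable_sum => i.
by apply: measurable_funM => //; exact: measurable_funM.
Qed.

Lemma gauss_ge0 t (B : set 'cV[R]_d) : (0 <= gauss t L B)%E.
Proof.
apply: integral_ge0 => y _; rewrite lee_fin gauss_pdfE.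
by rewrite mulr_ge0// ltW ?gauss_const_gt0 ?gker_gt0.
Qed.

(* The value is 1, but only its independence of t is needed. *)
Lemma gaussT : exists2 k : R, 0 < k & forall t, gauss t L setT = k%:E.
Proof.
exists (gauss_const L * gker_mass (invmx L)).
  by rewrite mulr_gt0 ?gauss_const_gt0 ?gker_mass_gt0.
move=> t; rewrite /gauss; under eq_integral do rewrite gauss_pdfE EFinM.
rewrite ge0_integralZl_EFin//; last 3 first.
- by move=> y _; rewrite lee_fin ltW// gker_gt0.
- by apply/measurable_EFinP; exact: measurable_gker.
- exact: ltW (gauss_const_gt0 pL).
by rewrite integral_gker// EFinM.
Qed.

Definition slab (w : 'cV[R]_d) (a b : R) : set 'cV[R]_d :=
  [set y | `[a, b]%classic (lin w y)].

Lemma measurable_slab (w : 'cV[R]_d) (a b : R) :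
  measurable (slab w a b).
Proof.
by rewrite -[X in measurable X]setTI; exact: measurable_lin.
Qed.

(** The kernel is dominated by an isotropic density, to which the slab estimate applies. Uniformity
    in the mean [t] lets the bound survive integration over [theta]. *)
Lemma gauss_slab (w : 'cV[R]_d) : w != 0 ->
  exists2 C, 0 <= C & forall t a h, 0 <= h ->
    (gauss t L (slab w a (a + h)%R) <= (C * h)%:E)%E.
Proof.
move=> w0; have [s [C1 [s0 C10 H1]]] := gker_le_iso_pdf pQ.
have [C2 C20 H2] := iso_pdf_slab s0 w0.
have g0 := ltW (gauss_const_gt0 pL).
exists (gauss_const L * C1 * C2); first by rewrite !mulr_ge0.
move=> t a h h0; rewrite /gauss integral_mkcond.
have mI : measurable_fun [set: 'cV[R]_d]
    (fun y => (iso_pdf s (fun i => t i 0) y * \1_`[a, a + h] (lin w y))%:E).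
  apply/measurable_EFinP; apply: measurable_funM; first exact: measurable_iso_pdf.
  by apply: measurableT_comp => //; exact: measurable_lin.
apply: (@le_trans _ _ (\int[lebesgue_cV d]_y ((gauss_const L * C1)%:E *
    (iso_pdf s (fun i => t i 0) y * \1_`[a, a + h] (lin w y))%:E))%E); last first.
  rewrite ge0_integralZl_EFin//; last 2 first.
  - by move=> y _; rewrite lee_fin mulr_ge0// iso_pdf_ge0.
  - by rewrite mulr_ge0.
  rewrite -[in leRHS](mulrA (_ * C1)) [leRHS]EFinM; apply: lee_wpmul2l; last exact: H2.
  by rewrite lee_fin mulr_ge0.
apply: ge0_le_integral => //.
- move=> y _; rewrite patchE; case: ifP => // _; rewrite lee_fin gauss_pdfE.
  by rewrite mulr_ge0// ltW// gker_gt0.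
- apply/(measurable_restrictT _ _).1 => //; first exact: measurable_slab.
  apply: measurable_funTS; apply/measurable_EFinP.
  by apply: measurable_funM => //; exact: measurable_gker.
- by apply: emeasurable_funM.
move=> y _; rewrite patchE -EFinM indicE.
case: (boolP (y \in _)) => [|_]; last first.
  by rewrite lee_fin !mulr_ge0// iso_pdf_ge0.
rewrite inE /= => ya; rewrite mem_set// mulr1 lee_fin gauss_pdfE -mulrA.
by rewrite ler_wpM2l//; exact: (H1 t y).1.
Qed.

End sampling.

Lemma emeasurable_prode (R : realType) dT (T : measurableType dT) (I : Type)
    (s : seq I) (f : I -> T -> \bar R) : (forall i, measurable_fun setT (f i)) ->
  measurable_fun setT (fun x => \prod_(i <- s) f i x)%E.
Proof.
move=> mf; elim: s => [|i s IH].
  by under eq_fun do rewrite big_nil; exact: measurable_cst.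
by under eq_fun do rewrite big_cons; apply: emeasurable_funM.
Qed.

Section hyperplane_null.
Context {R : realType} {d m : nat} {disp : measure_display}.
Context {Omega : measurableType disp} {P : probability Omega R}.
Variables (mupi : 'cV[R]_d) (Sigmapi Lambda : 'M[R]_d).
Variables (theta : {RV P >-> 'cV[R]_d}) (Y : 'I_m.+1 -> {RV P >-> 'cV[R]_d}).
Hypothesis pL : posdefmx Lambda.
Hypothesis hmodel : normal_normal_model mupi Sigmapi Lambda theta Y.

Lemma measurable_RV (X : {RV P >-> 'cV[R]_d}) (B : set 'cV[R]_d) :
  measurable B -> measurable (X @^-1` B).
Proof. by move=> mB; rewrite -[X in measurable X]setTI; exact: measurable_funP. Qed.

Lemma sample_prob (B : 'I_m.+1 -> set 'cV[R]_d) : (forall i, measurable (B i)) ->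
  P [set w | forall i, B i (Y i w)] =
  (\int[distribution P theta]_t \prod_i gauss t Lambda (B i))%E.
Proof.
move=> mB; rewrite -(hmodel.2 _ _ measurableT mB); congr (P _).
by apply/seteqP; split => w /=; [split|case].
Qed.

Definition ord_cons (T : Type) (a : T) (B : 'I_m -> T) (i : 'I_m.+1) : T :=
  if unlift ord0 i is Some j then B j else a.

Lemma ord_cons0 T (a : T) B : ord_cons a B ord0 = a.
Proof. by rewrite /ord_cons unlift_none. Qed.

Lemma ord_consS T (a : T) B j : ord_cons a B (lift ord0 j) = B j.
Proof. by rewrite /ord_cons liftK. Qed.

(** Conditional independence: for fixed [theta] the first observation contributes a factor at most
    [e], against [k] when it is unconstrained. The ratio [e / k] then passes through the integral
    over the law of [theta]. *)
Lemma sample_prob_le : exists2 k : R, 0 < k &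
  forall (A : set 'cV[R]_d) (B : 'I_m -> set 'cV[R]_d) (e : R),
  measurable A -> (forall i, measurable (B i)) -> 0 <= e ->
  (forall t, (gauss t Lambda A <= e%:E)%E) ->
  (P [set w | A (Y ord0 w) /\ forall i, B i (Y (lift ord0 i) w)] <=
   (e / k)%:E * P [set w | forall i, B i (Y (lift ord0 i) w)])%E.
Proof.
have [k k0 gk] := gaussT pL; exists k => // A B e mA mB e0 Ae.
have mC C : measurable C -> forall i, measurable (ord_cons C B i).
  move=> mC i; case: (unliftP ord0 i) => [j ->|->]; first by rewrite ord_consS.
  by rewrite ord_cons0.
rewrite (_ : [set w | _ /\ _] = [set w | forall i, ord_cons A B i (Y i w)]); last first.
  apply/seteqP; split => w /=.
    move=> [Aw Bw] i; case: (unliftP ord0 i) => [j ->|->]; first by rewrite ord_consS.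
    by rewrite ord_cons0.
  move=> h; split; first by have := h ord0; rewrite ord_cons0.
  by move=> i; have := h (lift ord0 i); rewrite ord_consS.
(* The event on the other observations becomes a full rectangle whose first side is the whole
   space. *)
rewrite [X in (_ * P X)%E](_ : _ =
  [set w | forall i, ord_cons setT B i (Y i w)]); last first.
  apply/seteqP; split => w /= h i.
    case: (unliftP ord0 i) => [j ->|->]; first by rewrite ord_consS.
    by rewrite ord_cons0.
  by have := h (lift ord0 i); rewrite ord_consS.
rewrite !sample_prob//; [|exact: mC..].
have mprod C : measurable C -> measurable_fun [set: 'cV[R]_d]
    (fun t => \prod_i gauss t Lambda (ord_cons C B i))%E.
  move=> mC'; apply: (@emeasurable_prode _ _ 'cV[R]_d) => i.
  by apply: measurable_gauss => //; exact: mC.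
have prod0 C t : (0 <= \prod_(i < m.+1) gauss t Lambda (ord_cons C B i))%E.
  by apply: prode_ge0 => i _; exact: gauss_ge0.
rewrite -ge0_integralZl_EFin//; last 2 first.
- exact: mprod.
- by rewrite divr_ge0// ltW.
apply: ge0_le_integral => //.
- exact: mprod.
- by apply: emeasurable_funM => //; exact: mprod.
move=> t _; rewrite !big_ord_recl !ord_cons0 gk muleA -EFinM divfK ?gt_eqF//.
apply: lee_pmul => //.
- exact: gauss_ge0.
- by apply: prode_ge0 => i _; exact: gauss_ge0.
by under eq_bigr do rewrite ord_consS; under [leRHS]eq_bigr do rewrite ord_consS.
Qed.

Lemma measurable_lin_RV (w : 'cV[R]_d) (X : {RV P >-> 'cV[R]_d}) :
  measurable_fun [set: Omega] (fun x => lin w (X x)).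
Proof. by apply: (measurableT_comp (measurable_lin w)); exact: measurable_funPT. Qed.

(* The real line is cut into cells of length h. On the event that the
   projections of the last m observations lie in prescribed cells, the first
   projection is confined to an interval of length (m + 1)h. *)
Lemma hyperplane_sum_prob_le (w : 'cV[R]_d) (c : R) : w != 0 ->
  exists2 C : R, 0 <= C & forall h, 0 < h ->
  (P [set x | (\sum_i lin w (Y i x))%R = c] <= (C * h)%:E)%E.
Proof.
move=> w0; have [C C0 HC] := gauss_slab pL w0.
have [k k0 Hk] := sample_prob_le.
exists (C * m.+1%:R / k) => [|h h0].
  by rewrite divr_ge0 ?mulr_ge0// ltW.
set E := [set x | _].
have mE : measurable E.
  have mf : measurable_fun [set: Omega] (fun x => \sum_i lin w (Y i x)).
    by apply: measurable_sum => i; exact: measurable_lin_RV.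
  by rewrite -[E]setTI; exact: (mf measurableT [set c]).
pose cell (z : int) : set 'cV[R]_d :=
  [set y | `[z%:~R * h, (z + 1)%:~R * h[%classic (lin w y)].
have cellP z y : (cell z y) <-> Num.floor (lin w y / h) = z.
  rewrite /cell /= in_itv/= -ler_pdivlMr// -ltr_pdivrMr//.
  by rewrite -floor_eq; split => /eqP.
have mcell z : measurable (cell z).
  by rewrite -[X in measurable X]setTI; exact: measurable_lin.
(* Coding the tuple of cell indices by a natural number turns the partition into a sequence of
   events [G j], empty when [j] codes no tuple. *)
pose kap x : nat := pickle [ffun i : 'I_m => Num.floor (lin w (Y (lift ord0 i) x) / h)].
pose F (g : {ffun 'I_m -> int}) := [set x | forall i, cell (g i) (Y (lift ord0 i) x)].
have mF g : measurable (F g).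
  by apply: measurable_forall_ord => i; exact: measurable_RV.
have kapP g x : kap x = pickle g <-> F g x.
  split=> [/(pcan_inj (@pickleK _))/ffunP gx i|Fx].
    by apply/cellP; rewrite -gx ffunE.
  by congr pickle; apply/ffunP => i; rewrite ffunE; exact/cellP.
pose G j := [set x | kap x = j].
have GE j : (exists g, G j = F g) \/ G j = set0.
  have [[g gj]|ng] := pselect (exists g : {ffun 'I_m -> int}, pickle g = j).
    by left; exists g; apply/seteqP; split => x; rewrite /G/= -gj => /kapP.
  right; apply/seteqP; split => // x Gx; apply: ng; eexists; exact: Gx.
have mG j : measurable (G j) by have [[g ->]|->] := GE j.
have tG : trivIset setT G by move=> i j _ _ [x [<- <-]].
have EG j : (P (E `&` G j) <= (C * m.+1%:R / k * h)%:E * P (G j))%E.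
  have [[g ->]|->] := GE j; last by rewrite setI0 measure0 mule0.
  (* On [E] the first projection is [c] minus the sum of the others, which lies between the sums of
     the lower and of the upper ends of the cells. These differ by [m * h]. *)
  pose a := c - \sum_i (g i + 1)%:~R * h.
  pose A := slab w a (a + m.+1%:R * h).
  have -> : C * m.+1%:R / k * h = C * (m.+1%:R * h) / k by field; rewrite gt_eqF.
  apply: le_trans (Hk A (fun i => cell (g i)) _ _ _ _ _) => //; last 3 first.
  - exact: measurable_slab.
  - by rewrite !mulr_ge0// ltW.
  - by move=> t; apply: HC; rewrite mulr_ge0// ltW.
  apply: le_measure; rewrite ?inE.
  - exact: measurableI.
  - exact: (measurableI _ _ (measurable_RV (Y ord0) (measurable_slab w _ _)) (mF g)).
  move=> x [Ex Fx]; split => //; rewrite /A /slab /= in_itv/=.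
  move: Ex; rewrite /E /= big_ord_recl => Ex.
  have lo : \sum_i (g i)%:~R * h <= \sum_i lin w (Y (lift ord0 i) x).
    by apply: ler_sum => i _; have := Fx i; rewrite /cell/= in_itv/= => /andP[].
  have hi : \sum_i lin w (Y (lift ord0 i) x) <= \sum_i (g i + 1)%:~R * h.
    by apply: ler_sum => i _; have := Fx i; rewrite /cell/= in_itv/= => /andP[_ /ltW].
  have gap : \sum_i (g i + 1)%:~R * h = \sum_i (g i)%:~R * h + m%:R * h.
    under eq_bigr do rewrite intrD mulrDl mul1r.
    by rewrite big_split/= sumr_const card_ord mulr_natl.
  by rewrite /a -natr1; apply/andP; split; nra.
have C'0 : 0 <= C * m.+1%:R / k * h.
  by rewrite !mulr_ge0 ?invr_ge0// ltW.
have mEG j : measurable (E `&` G j) by exact: measurableI.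
have EU : E `<=` \bigcup_j (E `&` G j) by move=> x Ex; exists (kap x).
(* Sum the bounds over the partition: the [G j] are disjoint, so their probabilities add up to at
   most 1. *)
apply: le_trans (measure_sigma_subadditive P mEG mE EU) _.
apply: (@le_trans _ _ (\sum_(0 <= j <oo) (C * m.+1%:R / k * h)%:E * P (G j))%E).
  by apply: lee_nneseries => [j _ _|j _]; [exact: measure_ge0|exact: EG].
rewrite nneseriesZl// -measure_semi_bigcup//; last exact: bigcup_measurable.
rewrite -[leRHS]mule1; apply: lee_wpmul2l; first by rewrite lee_fin.
by apply: probability_le1; exact: bigcup_measurable.
Qed.

Lemma hyperplane_sum_null (w : 'cV[R]_d) (c : R) : w != 0 ->
  P.-negligible [set x | \sum_i lin w (Y i x) = c].
Proof.
move=> w0; have [C C0 HC] := hyperplane_sum_prob_le c w0.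
set E := [set x | _] in HC *.
have mE : measurable E.
  have mf : measurable_fun [set: Omega] (fun x => \sum_i lin w (Y i x)).
    by apply: measurable_sum => i; exact: measurable_lin_RV.
  by rewrite -[E]setTI; exact: (mf measurableT [set c]).
apply/negligibleP => //; apply/eqP; rewrite eq_le measure_ge0 andbT.
apply/lee_addgt0Pr => e e0; rewrite add0e.
(* Letting the cell width shrink: this choice gives a bound at most [e], also when [C = 0]. *)
apply: le_trans (HC (e / (C + 1)) _) _; first by rewrite divr_gt0// ltr_wpDl.
rewrite lee_fin mulrA ler_pdivrMr ?ltr_wpDl//; nra.
Qed.

End hyperplane_null.

(** * Directions with a discrepancy *)

Section directions.
Context {R : realType} {d : nat}.
Implicit Types (a b lam v : 'cV[R]_d).

Lemma linBr lam a b : lin lam (a - b) = lin lam a - lin lam b.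
Proof. by rewrite /lin mulmxBr !mxE. Qed.

(* The direction below has the Gram determinant of a and b as its scalar
   product with either of them. *)
Lemma exists_common_halfspace a b : a != 0 -> (forall s, b != s *: a) ->
  exists lam, 0 < lin lam a /\ 0 < lin lam b.
Proof.
move=> a0 ba; pose f := bform (1%:M : 'M[R]_d).
have linf x y : lin x y = f x y by rewrite /f bform_lin mul1mx.
have p1 : posdefmx (1%:M : 'M[R]_d) := posdefmx1.
have fa : 0 < f a a by exact: p1.2.
have fC : f b a = f a b by exact: bformC p1.1.
have gram : 0 < f a a * f b b - f a b ^+ 2.
  (* This is the component of [b] orthogonal to [a], scaled by [f a a]; its squared norm is [f a a]
     times the Gram determinant. *)
  have u0 : f a a *: b - f a b *: a != 0.
    rewrite subr_eq0; apply: contra (ba (f a b / f a a)) => /eqP h.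
    by rewrite mulrC -scalerA -h scalerA mulVf ?gt_eqF// scale1r.
  have := p1.2 _ u0; rewrite -/(bform _ _ _) -/f.
  rewrite /f !(bformDl, bformDr, bformNl, bformNr, bformZl, bformZr) -/f fC => h.
  by rewrite -(pmulr_rgt0 _ fa); apply: lt_le_trans h _;
    rewrite le_eqVlt; apply/orP; left; apply/eqP; ring.
exists ((f b b - f a b) *: a + (f a a - f a b) *: b).
rewrite !linf; split.
  apply: lt_le_trans gram _; rewrite le_eqVlt; apply/orP; left; apply/eqP.
  by rewrite /f !(bformDl, bformZl) -/f fC; ring.
apply: lt_le_trans gram _; rewrite le_eqVlt; apply/orP; left; apply/eqP.
by rewrite /f !(bformDl, bformZl) -/f; ring.
Qed.

(** Induction on the size of [p], dividing out one root at a time. *)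
Lemma finite_roots (p : {poly R}) : p != 0 ->
  exists s : seq R, forall x, root p x -> x \in s.
Proof.
have [k] := ubnP (size p); elim: k p => // k IH p pk p0.
have [[x px]|npx] := pselect (exists x, root p x); last first.
  by exists [::] => x px; case: npx; exists x.
have /factor_theorem[q pE] := px.
have q0 : q != 0 by apply: contraNneq p0 => q0; rewrite pE q0 mul0r.
have [|s sq] := IH q _ q0.
  by move: pk; rewrite pE size_Mmonic ?monicXsubC// size_XsubC addn2.
exists (x :: s) => y; rewrite pE rootM root_XsubC inE orbC => /orP[->//|/sq->].
by rewrite orbT.
Qed.

Lemma finite_generalized_eigenvalues (A B : 'M[R]_d) : B \in unitmx ->
  exists s : seq R, forall v c, v != 0 -> A *m v = c *: (B *m v) -> c \in s.
Proof.
(* Such a [c] is an eigenvalue of [invmx B *m A]; the transpose is taken because [eigenvalue] refers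
   to row vectors. *)
move=> uB; pose T := (invmx B *m A)^T.
have [|s sP] := @finite_roots (char_poly T).
  exact: monic_neq0 (char_poly_monic T).
exists s => v c v0 vE; apply: sP; rewrite -eigenvalue_root_char.
apply/eigenvalueP; exists v^T; last first.
  by apply: contra_neq v0 => /(congr1 trmx); rewrite trmxK trmx0.
by rewrite /T -trmx_mul -mulmxA vE -scalemxAr mulKmx// linearZ.
Qed.

End directions.

(** * Exceptional hyperplanes *)

Section proportionality.
Context {R : realType} {d : nat}.
Variables (S L : 'M[R]_d).
Hypotheses (d0 : (0 < d)%N) (pS : posdefmx S) (pL : posdefmx L).
Hypothesis hnprop : ~ exists2 c : R, c != 0 & c *: L = S.

Lemma invmx_not_proportional c : invmx S != c *: invmx L.
Proof.
apply/eqP => h; have uS := posdefmx_unit pS; have uL := posdefmx_unit pL.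
have c0 : c != 0.
  (* With [c = 0] the inverse of [S] would be the zero matrix, whose determinant vanishes in
     positive dimension. *)
  apply/eqP => c0; have := @posdefmx_det_gt0 R d _ (posdefmx_inv pS).
  by rewrite h c0 scale0r -(prednK d0) det0 ltxx.
apply: hnprop; exists c^-1; first by rewrite invr_eq0.
rewrite -[RHS]invmxK h invmxZ ?invmxK//.
by rewrite -h unitmx_inv.
Qed.

(** The matrix [invmx S - c *: invmx L] is non-zero, so it has a non-zero row, and its kernel is
    orthogonal to that row. *)
Lemma generalized_eigenspace_hyperplane c : exists2 w : 'cV[R]_d, w != 0 &
  forall v, invmx S *m v = c *: (invmx L *m v) -> lin w v = 0.
Proof.
have := invmx_not_proportional c; rewrite -subr_eq0 => D0.
have [i Di] : exists i, row i (invmx S - c *: invmx L) != 0.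
  apply/existsP; apply: contraNT D0; rewrite negb_exists => /forallP h.
  by apply/eqP/row_matrixP => i; rewrite row0; apply/eqP; rewrite -[_ == _]negbK.
exists (row i (invmx S - c *: invmx L))^T.
  by apply: contra_neq Di => /(congr1 trmx); rewrite trmxK trmx0.
move=> v vE; rewrite /lin trmxK -row_mul mulmxBl -scalemxAl vE subrr row0.
by rewrite mxE.
Qed.

End proportionality.

(** * From non-exceptional data to the discrepancy *)

Section dpp_occurs.
Context {R : realType} {d m : nat}.
Variables (mupi : 'cV[R]_d) (S L : 'M[R]_d) (y : 'I_m.+1 -> 'cV[R]_d).
Hypotheses (pS : posdefmx S) (pL : posdefmx L).

Let v := \sum_i y i - m.+1%:R *: mupi.

Lemma dpp_halfspaces : v != 0 ->
  (forall c, invmx S *m v != c *: (invmx L *m v)) ->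
  exists U : set 'cV[R]_d,
    [/\ measurable U, (0 < lebesgue_cV d U)%E &
        forall lam, U lam -> dpp mupi S L y lam].
Proof.
move=> v0 hv; pose A := invmx S; pose B := invmx L; pose Q := A + m.+1%:R *: B.
pose mup := posterior_mean mupi S L y.
have QE : Q *m mup = A *m mupi + B *m \sum_i y i by exact: posterior_meanP.
pose a := mup - mupi; pose b := mup - likelihood_mean y.
have n0 : m.+1%:R != 0 :> R by rewrite pnatr_eq0.
have sumE : \sum_i y i = m.+1%:R *: likelihood_mean y.
  by rewrite /likelihood_mean scalerA divff// scale1r.
have Qa : Q *m a = B *m v.
  rewrite mulmxBr QE mulmxDl -scalemxAl opprD addrACA subrr add0r.
  by rewrite /v mulmxBr -scalemxAr.
have Qb : Q *m b = - (m.+1%:R^-1 *: (A *m v)).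
  rewrite mulmxBr QE mulmxDl -scalemxAl sumE -scalemxAr opprD addrACA subrr addr0.
  have -> : v = m.+1%:R *: (likelihood_mean y - mupi) by rewrite scalerBr -sumE.
  by rewrite -[X in _ = - (_ *: X)]scalemxAr scalerA mulVf// scale1r mulmxBr opprB.
have uB : B \in unitmx by exact/posdefmx_unit/posdefmx_inv.
have a0 : a != 0.
  apply: contra_neq v0 => a0; move: Qa; rewrite a0 mulmx0.
  by move/(congr1 (mulmx (invmx B))); rewrite mulmx0 mulKmx.
have ba s : b != s *: a.
  (* Applying [Q] to [b = s *: a] would give [A *m v = - (n * s) *: (B *m v)] with [n = m.+1], which
     [hv] excludes. *)
  apply/eqP => bE; move/eqP: (hv (- (m.+1%:R * s))); apply.
  move: Qb; rewrite bE -scalemxAr Qa => /(congr1 (fun x => - m.+1%:R *: x)).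
  by rewrite scalerN !scaleNr opprK !scalerA divff// scale1r => <-.
have [lam0 [la lb]] := exists_common_halfspace a0 ba.
exists [set lam | 0 < lin lam a * lin lam b]; split.
- exact: measurable_halfspaces.
- exact: halfspaces_gt0 la lb.
by move=> lam /=; rewrite /dpp /a /b !linBr.
Qed.

End dpp_occurs.

Theorem theorem3p5 (R : realType) (d n : nat) (hd : (1 < d)%N) (hn : (0 < n)%N)
    (mupi : 'cV[R]_d) (Sigmapi Lambda : 'M[R]_d)
    (hSigmapi : posdefmx Sigmapi) (hLambda : posdefmx Lambda)
    (disp : measure_display) (Omega : measurableType disp)
    (P : probability Omega R)
    (theta : {RV P >-> 'cV[R]_d}) (Y : 'I_n -> {RV P >-> 'cV[R]_d})
    (hmodel : normal_normal_model mupi Sigmapi Lambda theta Y)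
    (hnprop : ~ exists2 c : R, c != 0 & c *: Lambda = Sigmapi) :
  {ae P, forall w, exists S : set 'cV[R]_d,
    [/\ measurable S,
        (0 < lebesgue_cV d S)%E &
        forall lam, S lam ->
          dpp mupi Sigmapi Lambda (fun i => Y i w) lam]}.
Proof.
case: n hn Y hmodel => // m _ Y hmodel.
have uL : invmx Lambda \in unitmx by exact/posdefmx_unit/posdefmx_inv.
have [s sP] := finite_generalized_eigenvalues (invmx Sigmapi) uL.
(* One normal vector is chosen for every [c], so that the finite list [s] indexes finitely many
   hyperplanes. *)
have /choice[w wP] c : exists w : 'cV[R]_d, w != 0 /\
    forall v, invmx Sigmapi *m v = c *: (invmx Lambda *m v) -> lin w v = 0.
  have [w ? ?] := generalized_eigenspace_hyperplane (ltnW hd) hSigmapi hLambda hnprop c.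
  by exists w.
pose v x := \sum_i Y i x - m.+1%:R *: mupi.
(* The condition on [v x] places the sum of the observations on a hyperplane of normal [w c],
   shifted according to the prior mean. *)
have null c : P.-negligible [set x | lin (w c) (v x) = 0].
  apply: negligibleS (hyperplane_sum_null hLambda hmodel
    (lin (w c) (m.+1%:R *: mupi)) (wP c).1).
  move=> x /= /eqP; rewrite linBr subr_eq0 => /eqP <-.
  by rewrite /lin mulmx_sumr summxE.
have nulls (r : seq R) : P.-negligible
    [set x | exists2 c, c \in r & lin (w c) (v x) = 0].
  elim: r => [|c r IH]; first by apply: negligibleS (negligible_set0 P) => x [].
  apply: negligibleS (negligibleU (null c) IH) => x [e].
  by rewrite inE => /predU1P[->|er] h; [left|right; exists e].
(* The additional entry 0 covers the event [v x = 0], since every one of these hyperplanes contains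
   the origin. *)
apply: negligibleS (nulls (0 :: s)) => x /= ndpp; apply: contrapT => ngood.
apply: ndpp; apply: dpp_halfspaces => //.
  apply/eqP => v0; apply: ngood; exists 0; first by rewrite mem_head.
  by rewrite /v v0 /lin mulmx0 mxE.
move=> c; apply/eqP => vc; apply: ngood.
have [v0|v0] := eqVneq (v x) 0.
  by exists 0; rewrite ?mem_head// v0 /lin mulmx0 mxE.
exists c; last exact: (wP c).2.
by rewrite inE orbC (sP (v x) c v0 vc).
Qed.
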